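(* Let $D$ be an integral domain. Then $D$ is factorial (that is, a unique factorization domain) if and only if $D$ is length-factorial.
   Context: An integral domain $D$ is atomic if every nonzero nonunit of $D$ can be written as a finite product of irreducible elements. $D$ is factorial (a UFD) if it is atomic and whenever $x_1\cdots x_n = y_1\cdots y_m$ with all $x_i$ and $y_j$ irreducible in $D$, then (1) $n=m$, and (2) there is a permutation $\sigma$ of $\{1,\ldots,n\}$ such that for each $1\le i\le n$ we have $x_i = u_i y_{\sigma(i)}$ for some unit $u_i$ of $D$. $D$ is length-factorial if it is atomic and whenever $x_1\cdots x_n = y_1\cdots y_n$ (the same number $n$ of factors on both sides) with all $x_i$ and $y_j$ irreducible in $D$, then there is a permutation $\sigma$ of $\{1,\ldots,n\}$ such that for each $1\le i\le n$ we have $x_i = u_i y_{\sigma(i)}$ for some unit $u_i$ of $D$. *)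

(* Defs.v *)
From HB Require Import structures.
From mathcomp Require Import all_boot all_order all_algebra all_fingroup.

Set Implicit Arguments.
Unset Strict Implicit.
Unset Printing Implicit Defensive.

Import GRing.Theory.
Local Open Scope ring_scope.

Definition irreducible (D : idomainType) (x : D) : Prop :=
  [/\ x != 0, x \isn't a GRing.unit &
      forall a b : D, x = a * b -> a \is a GRing.unit \/ b \is a GRing.unit].

(* The length n = 0 is allowed here and below. It adds nothing: the empty
   product 1 is a unit, and a product of n > 0 irreducibles is never a unit. *)
Definition atomic (D : idomainType) : Prop :=
  forall x : D, x != 0 -> x \isn't a GRing.unit ->
  exists (n : nat) (a : 'I_n -> D),
    (forall i, irreducible (a i)) /\ x = \prod_(i < n) a i.

Definition same_up_to_units (D : idomainType) (n : nat) (x y : 'I_n -> D) :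
    Prop :=
  exists s : 'S_n, forall i : 'I_n,
    exists2 u : D, u \is a GRing.unit & x i = u * y (s i).

(* cast_ord only transports indices along n = m. *)
Definition factorial_domain (D : idomainType) : Prop :=
  atomic D /\
  forall (n m : nat) (x : 'I_n -> D) (y : 'I_m -> D),
    (forall i, irreducible (x i)) -> (forall j, irreducible (y j)) ->
    \prod_(i < n) x i = \prod_(j < m) y j ->
    exists e : n = m, same_up_to_units x (fun i => y (cast_ord e i)).

Definition length_factorial_domain (D : idomainType) : Prop :=
  atomic D /\
  forall (n : nat) (x y : 'I_n -> D),
    (forall i, irreducible (x i)) -> (forall j, irreducible (y j)) ->
    \prod_(i < n) x i = \prod_(j < n) y j ->
    same_up_to_units x y.

(* Main.v *)
(** Let [x1 X ~ y1 Y] be a relation between products of irreducibles of distinct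
    lengths whose length difference is minimal and whose two sides share no
    irreducible. In a length-factorial domain, every relation between products of
    distinct lengths contains this one: dividing by it lowers the length
    difference, and at difference zero both sides agree. Now
    [x1 (X + y1) = y1 (u Y + x1)] for a unit [u]. After factoring both
    parenthesized terms, this is a new relation, so that either [y1] divides
    [X + y1], hence [X], or [X] divides [X + y1], hence [y1]. Both are
    impossible, so all relations are between products of the same length. *)

Require Import Defs.
From mathcomp Require Import all_boot all_order all_algebra all_fingroup.
From mathcomp Require Import boolp zify ring.

Set Implicit Arguments.
Unset Strict Implicit.
Unset Printing Implicit Defensive.

Import GRing.Theory.
Local Open Scope ring_scope.

(** * Associates, and lists of irreducibles compared by multiplicities up to units *)

Section Associates.
Variable D : idomainType.
Implicit Types (a b c x y : D) (s t w : seq D).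

Definition assoc x y : Prop := exists2 u : D, u \is a GRing.unit & x = u * y.

Definition divides x y : Prop := exists c, y = c * x.

Definition irreducibles s : Prop := forall a, a \in s -> irreducible a.

Definition prods s : D := \prod_(a <- s) a.

(** Counting up to units turns the matching of factorizations into equalities and inequalities of
    numbers, with no permutation to carry along. *)
Definition mult a s : nat := count (fun b => `[< assoc a b >]) s.

Lemma assoc_refl x : assoc x x.
Proof. by exists 1; rewrite ?unitr1 ?mul1r. Qed.

Lemma assoc_sym x y : assoc x y -> assoc y x.
Proof. by case=> u Uu ->; exists u^-1; rewrite ?unitrV ?mulKr. Qed.

Lemma assoc_trans y x z : assoc x y -> assoc y z -> assoc x z.
Proof.
by move=> [u Uu ->] [v Uv ->]; exists (u * v); rewrite ?unitrM ?Uu ?mulrA.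
Qed.

Lemma assocM x y x' y' : assoc x x' -> assoc y y' -> assoc (x * y) (x' * y').
Proof.
move=> [u Uu ->] [v Uv ->]; exists (u * v); first by rewrite unitrM Uu.
by rewrite mulrACA.
Qed.

Lemma assoc_mul2l c x y : c != 0 -> assoc (c * x) (c * y) -> assoc x y.
Proof.
by move=> c0 [u Uu E]; exists u => //; apply: (mulfI c0); rewrite E mulrCA.
Qed.

Lemma irreducible_unitM u a :
  u \is a GRing.unit -> irreducible a -> irreducible (u * a).
Proof.
move=> Uu [a0 Na ia]; split.
- by rewrite mulf_neq0 //; apply: contraTneq Uu => ->; rewrite unitr0.
- by rewrite unitrM Uu.
- move=> b c E; have : a = (u^-1 * b) * c by rewrite -mulrA -E mulKr.
  by case/ia; rewrite ?unitrM ?unitrV ?Uu /=; [left|right].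
Qed.

Lemma prods_cons a s : prods (a :: s) = a * prods s.
Proof. by rewrite /prods big_cons. Qed.

Lemma prods_cat s t : prods (s ++ t) = prods s * prods t.
Proof. by rewrite /prods big_cat. Qed.

Lemma prods_perm s t : perm_eq s t -> prods s = prods t.
Proof. by move=> E; rewrite /prods (perm_big _ E). Qed.

Lemma irreducibles_cons a s :
  irreducibles (a :: s) <-> irreducible a /\ irreducibles s.
Proof.
split=> [Hs|[Ha Hs] b]; last by rewrite inE => /predU1P[->|/Hs].
split; first by apply: Hs; rewrite mem_head.
by move=> b Hb; apply: Hs; rewrite inE Hb orbT.
Qed.

Lemma irreducibles_cat s t :
  irreducibles s -> irreducibles t -> irreducibles (s ++ t).
Proof. by move=> Hs Ht a; rewrite mem_cat => /orP[/Hs|/Ht]. Qed.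

Lemma irreducibles_rem a s : irreducibles s -> irreducibles (rem a s).
Proof. by move=> Hs b /mem_rem/Hs. Qed.

Lemma prods_neq0 s : irreducibles s -> prods s != 0.
Proof.
elim: s => [_|a s IH /irreducibles_cons[[a0 _ _] /IH s0]].
  by rewrite /prods big_nil oner_neq0.
by rewrite prods_cons mulf_neq0.
Qed.

Lemma prods_unit s : irreducibles s -> prods s \is a GRing.unit -> s = [::].
Proof.
case: s => // a s /irreducibles_cons[[_ Na _] _].
by rewrite prods_cons unitrM (negPf Na).
Qed.

Lemma mult_cons a b s : mult a (b :: s) = (`[< assoc a b >] + mult a s)%N.
Proof. by []. Qed.

Lemma mult_head a s : (0 < mult a (a :: s))%N.
Proof. by rewrite mult_cons (asboolT (assoc_refl a)). Qed.

Lemma mult_cat a s t : mult a (s ++ t) = (mult a s + mult a t)%N.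
Proof. exact: count_cat. Qed.

Lemma asbool_assoc a b c : assoc b c -> `[< assoc a b >] = `[< assoc a c >].
Proof.
move=> bc; apply/asboolP/asboolP => H; first exact: assoc_trans bc.
exact: assoc_trans (assoc_sym bc).
Qed.

Lemma mult_gt0 a s : (0 < mult a s)%N -> exists2 b, b \in s & assoc a b.
Proof. by rewrite /mult -has_count => /hasP[b bs /asboolP]; exists b. Qed.

Lemma mult_rem a b s : b \in s ->
  mult a s = (`[< assoc a b >] + mult a (rem b s))%N.
Proof. by move=> /perm_to_rem/seq.permP E; rewrite /mult E. Qed.

Lemma prods_rem b s : b \in s -> prods s = b * prods (rem b s).
Proof. by move=> /perm_to_rem/prods_perm->; rewrite prods_cons. Qed.

Lemma mult_dvd a s : (0 < mult a s)%N -> divides a (prods s).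
Proof.
case/mult_gt0=> b bs /assoc_sym[u _ Eb]; exists (u * prods (rem b s)).
by rewrite (prods_rem bs) {1}Eb; ring.
Qed.

(** An associate of the head of [s] occurs in [t]; removing both lowers each multiplicity by the
    same amount on the two sides, so induction applies. *)
Lemma prods_dvd s t :
  (forall a, (mult a s <= mult a t)%N) -> divides (prods s) (prods t).
Proof.
elim: s t => [|a s IH] t le_st.
  by exists (prods t); rewrite /prods big_nil mulr1.
have /mult_gt0[b bt ab] : (0 < mult a t)%N.
  by apply: leq_trans (le_st a); apply: mult_head.
have [c|c Ec] := IH (rem b t).
  by have := le_st c; rewrite mult_cons (mult_rem c bt) (asbool_assoc c ab) leq_add2l.
case: (assoc_sym ab) => u _ Eb.
exists (u * c); rewrite (prods_rem bt) Ec prods_cons Eb; ring.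
Qed.

(** Removing a pair of associates keeps the products associate and the difference of sizes fixed,
    and [s] shrinks. The size equation expresses that difference without truncated subtraction. *)
Lemma cancel_common s t : irreducibles s -> irreducibles t ->
  assoc (prods s) (prods t) ->
  exists s' t', [/\ irreducibles s', irreducibles t',
    assoc (prods s') (prods t'), (size s' + size t = size s + size t')%N &
    forall a, mult a s' = 0%N \/ mult a t' = 0%N].
Proof.
have [n] := ubnP (size s); elim: n s t => // n IH s t sz Hs Ht st.
have [/asboolP dis|] := boolP `[< forall a, mult a s = 0%N \/ mult a t = 0%N >].
  by exists s, t.
move=> /asboolP/existsNP[a /not_orP[/eqP]].
rewrite -lt0n => /mult_gt0[b bs ab] /eqP; rewrite -lt0n => /mult_gt0[c ct ac].
have bc : assoc b c := assoc_trans (assoc_sym ab) ac.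
have b0 : b != 0 by case: (Hs b bs).
have szb := perm_size (perm_to_rem bs); have szc := perm_size (perm_to_rem ct).
rewrite /= in szb szc.
have [||||s' [t' [Hs' Ht' st' sz' dis]]] := IH (rem b s) (rem c t).
- by rewrite szb ltnS in sz.
- exact: irreducibles_rem.
- exact: irreducibles_rem.
- apply: (assoc_mul2l b0); rewrite -prods_rem //.
  apply: assoc_trans st _; rewrite (prods_rem ct).
  by apply: assocM (assoc_refl _); apply: assoc_sym.
by exists s', t'; split=> //; move: sz'; rewrite szb szc; lia.
Qed.

(** With [assoc] in place of equality, units factor too, through the empty list. *)
Lemma atomic_factor x : atomic D -> x != 0 ->
  exists2 s, irreducibles s & assoc x (prods s).
Proof.
move=> atD x0; have [Ux|Nx] := boolP (x \is a GRing.unit).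
  by exists [::] => //; exists x; rewrite // /prods big_nil mulr1.
have [n [a [Ha ->]]] := atD x x0 Nx.
exists [seq a i | i <- enum 'I_n]; first by move=> b /mapP[i _ ->].
by rewrite /prods big_map big_enum; apply: assoc_refl.
Qed.

End Associates.

(** * Relations between products of irreducibles in a length-factorial domain *)

Section LengthFactorial.
Variable D : idomainType.
Hypothesis lfD : length_factorial_domain D.
Implicit Types (a b c x y : D) (s t w : seq D).

Lemma mult_eq_of_prods_eq s t : irreducibles s -> irreducibles t ->
  prods s = prods t -> size s = size t -> forall a, mult a s = mult a t.
Proof.
move=> Hs Ht st sz a.
have Hx (i : 'I_(size s)) : irreducible (tnth (in_tuple s) i).
  by apply: Hs; apply: mem_tnth.
pose y (i : 'I_(size s)) := tnth (in_tuple t) (cast_ord sz i).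
have Hy i : irreducible (y i) by apply: Ht; apply: mem_tnth.
have Et : t = [seq y i | i <- enum 'I_(size s)].
  apply: (@eq_from_nth _ 0); first by rewrite size_map size_enum_ord.
  move=> i it; have is_ : (i < size s)%N by rewrite sz.
  rewrite (nth_map (Ordinal is_)) ?size_enum_ord // /y (tnth_nth 0) /=.
  by rewrite nth_enum_ord.
have Es : s = [seq tnth (in_tuple s) i | i <- enum 'I_(size s)].
  by rewrite map_tnth_enum.
have [|p Hp] := lfD.2 _ _ _ Hx Hy.
  transitivity (prods s).
    by rewrite (congr1 (@prods D) Es) /prods big_map big_enum.
  by rewrite st (congr1 (@prods D) Et) /prods big_map big_enum.
(* Both counts become sums over indices, and the permutation [p] reindexes one into the other. *)
rewrite (congr1 (mult a) Et) (congr1 (mult a) Es) /mult [LHS]count_map [RHS]count_map.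
rewrite -[LHS]sum1_count -[RHS]sum1_count !big_enum_cond /=.
rewrite [RHS](reindex_inj (@perm_inj _ p)) /=.
by apply: eq_bigl => i; apply: asbool_assoc; apply: Hp.
Qed.

(** The unit is absorbed into the head of [t]; if [t] has no head, [s] is empty as well. *)
Lemma mult_eq_of_assoc s t : irreducibles s -> irreducibles t ->
  assoc (prods s) (prods t) -> size s = size t ->
  forall a, mult a s = mult a t.
Proof.
move=> Hs; case: t => [|c t]; first by move=> _ _ /size0nil->.
move=> /irreducibles_cons[Hc Ht] [u Uu st] sz a.
rewrite (@mult_eq_of_prods_eq s (u * c :: t)) //.
- rewrite !mult_cons; congr (nat_of_bool _ + _)%N.
  by apply: asbool_assoc; exists u.
- by apply/irreducibles_cons; split=> //; apply: irreducible_unitM.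
- by rewrite st !prods_cons mulrA.
Qed.

(** * A minimal relation of unequal lengths and the contradiction it yields *)

Section MinimalRelation.
Variables (d : nat) (z1 z2 : seq D).
Hypotheses (irr1 : irreducibles z1) (irr2 : irreducibles z2).
Hypotheses (z12 : assoc (prods z1) (prods z2)) (d_gt0 : (0 < d)%N).
Hypothesis size_z12 : size z1 = (d + size z2)%N.
Hypothesis disjoint_z12 : forall a, mult a z1 = 0%N \/ mult a z2 = 0%N.
Hypothesis min_d : forall s t, irreducibles s -> irreducibles t ->
  assoc (prods s) (prods t) -> (size t < size s)%N ->
  (d + size t <= size s)%N.

(** Division is replaced by cross-multiplication: [s ++ z2] against [t ++ z1] has its length
    difference lowered by [d], and [min_d] keeps it nonnegative. As each [a] is missing from [z1] or
    from [z2], the bounds for the new pair give those for [s] and [t]. *)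
Lemma minimal_relation_sub s t : irreducibles s -> irreducibles t ->
  assoc (prods s) (prods t) -> (size t < size s)%N ->
  forall a, (mult a z1 <= mult a s)%N /\ (mult a z2 <= mult a t)%N.
Proof.
have [n] := ubnP (size s - size t); elim: n s t => // n IH s t sz Hs Ht st lt_ts.
have le_d := min_d Hs Ht st lt_ts => a.
have Hsz := irreducibles_cat Hs irr2; have Htz := irreducibles_cat Ht irr1.
have stz : assoc (prods (s ++ z2)) (prods (t ++ z1)).
  by rewrite !prods_cat; apply: assocM (assoc_sym z12).
have dis := disjoint_z12 a.
have [eq_sz|ne_sz] := eqVneq (size (s ++ z2)) (size (t ++ z1)).
  have := mult_eq_of_assoc Hsz Htz stz eq_sz a; rewrite !mult_cat; lia.
rewrite !size_cat in ne_sz.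
have [||] := IH (s ++ z2) (t ++ z1) _ Hsz Htz stz _ a;
  rewrite ?size_cat ?mult_cat; lia.
Qed.

Lemma minimal_relation_absurd : False.
Proof.
move: minimal_relation_sub => sub.
case E1: z1 => [|x1 X]; first by move: size_z12; rewrite E1 /=; lia.
have [Hx1 HX] : irreducible x1 /\ irreducibles X.
  by apply/irreducibles_cons; rewrite -E1.
have [x1_neq0 Nx1 _] := Hx1.
case E2: z2 => [|y1 Y].
  have /(prods_unit irr1) : prods z1 \is a GRing.unit.
    by case: z12 => u Uu ->; rewrite E2 /prods big_nil mulr1.
  by rewrite E1.
have [Hy1 HY] : irreducible y1 /\ irreducibles Y.
  by apply/irreducibles_cons; rewrite -E2.
have [y1_neq0 Ny1 irr_y1] := Hy1.
have y1z2 : (0 < mult y1 z2)%N by rewrite E2 mult_head.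
have [y1x1 y1X] : `[< assoc y1 x1 >] = false /\ mult y1 X = 0%N.
  have : mult y1 z1 = 0%N by case: (disjoint_z12 y1) y1z2 => // ->.
  by rewrite E1 mult_cons; case: asbool.
(* Absence of [y1] from [X] does not by itself exclude divisibility, so a factorization [W] of the
   quotient is compared with [X]. If [X] is longer than [y1 :: W], it has at least as many
   associates of [x1] as [x1 :: X]; otherwise [y1] would occur in [X]. *)
have NyX : ~ divides y1 (prods X).
  case=> k EX; have k0 : k != 0.
    by have := prods_neq0 HX; rewrite EX mulf_eq0 => /norP[].
  have [W HW kW] := atomic_factor lfD.1 k0.
  have HyW : irreducibles (y1 :: W) by apply/irreducibles_cons.
  have XyW : assoc (prods X) (prods (y1 :: W)).
    by rewrite prods_cons EX mulrC; apply: assocM (assoc_refl _) kW.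
  have yW := mult_head y1 W.
  case: (ltngtP (size (y1 :: W)) (size X)) => [lt|gt|eq].
  - have [] := sub _ _ HX HyW XyW lt x1.
    by rewrite E1 mult_cons (asboolT (assoc_refl x1)) add1n ltnn.
  - by have [_] := sub _ _ HyW HX (assoc_sym XyW) gt y1; rewrite y1X leqNgt y1z2.
  - by have := mult_eq_of_assoc HX HyW XyW (esym eq) y1; rewrite y1X; lia.
have [u Uu] : assoc (x1 * prods X) (y1 * prods Y).
  by rewrite -!prods_cons -E1 -E2.
move=> EXY.
(* Adding [x1 * y1] to both sides of [EXY] lets each side factor again. *)
have key : x1 * (prods X + y1) = y1 * (u * prods Y + x1).
  by rewrite mulrDr EXY; ring.
have NyXy : ~ divides y1 (prods X + y1).
  by case=> k Ek; apply: NyX; exists (k - 1); rewrite mulrBl mul1r -Ek addrK.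
have P0 : prods X + y1 != 0.
  by apply/eqP => E0; apply: NyXy; exists 0; rewrite E0 mul0r.
have Q0 : u * prods Y + x1 != 0.
  have : y1 * (u * prods Y + x1) != 0 by rewrite -key mulf_neq0.
  by rewrite mulf_eq0 => /norP[].
have [P HP XP] := atomic_factor lfD.1 P0.
have [Q HQ YQ] := atomic_factor lfD.1 Q0.
have HxP : irreducibles (x1 :: P) by apply/irreducibles_cons.
have HyQ : irreducibles (y1 :: Q) by apply/irreducibles_cons.
have PQ : assoc (prods (x1 :: P)) (prods (y1 :: Q)).
  rewrite !prods_cons.
  apply: assoc_trans (assocM (assoc_refl x1) (assoc_sym XP)) _.
  by rewrite key; apply: assocM (assoc_refl _) YQ.
have y1P : mult y1 (x1 :: P) = 0%N.
  rewrite mult_cons y1x1 add0n; apply/eqP; rewrite -leqn0 leqNgt.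
  apply/negP=> /mult_dvd[k Ek]; apply: NyXy; case: XP => v _ ->.
  by exists (v * k); rewrite Ek mulrA.
have yQ := mult_head y1 Q.
(* If [x1 :: P] is longer, it contains [x1 :: X], so [prods X] divides [prods X + y1] and hence
   [y1]. Otherwise [y1] would occur in [x1 :: P]. *)
case: (ltngtP (size (y1 :: Q)) (size (x1 :: P))) => [lt|gt|eq].
- have [k Ek] : divides (prods X) (prods P).
    apply: prods_dvd => a; have [le _] := sub _ _ HxP HyQ PQ lt a.
    by move: le; rewrite E1 !mult_cons leq_add2l.
  have [v _ Ev] := XP.
  have Ey1 : y1 = (v * k - 1) * prods X.
    by rewrite mulrBl mul1r -mulrA -Ek -Ev addrAC subrr add0r.
  (* A unit cofactor makes [y1] divide [prods X]. A unit [prods X] leaves [X] empty, so [z1] has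
     size 1, too short for a nonempty [z2] and a positive [d]. *)
  case: (irr_y1 _ _ Ey1) => [Uk|UX].
    by apply: NyX; exists (v * k - 1)^-1; rewrite [in RHS]Ey1 mulKr.
  have EX := prods_unit HX UX.
  by move: size_z12; rewrite E1 E2 EX /=; lia.
- by have [_] := sub _ _ HyQ HxP (assoc_sym PQ) gt y1; rewrite y1P leqNgt y1z2.
- by have := mult_eq_of_assoc HxP HyQ PQ (esym eq) y1; rewrite y1P; lia.
Qed.

End MinimalRelation.

(** Strong induction on the length difference [d]: the induction hypothesis makes [d] minimal, and
    cancelling common factors makes the two sides disjoint. *)
Lemma length_eq_of_assoc s t : irreducibles s -> irreducibles t ->
  assoc (prods s) (prods t) -> size s = size t.
Proof.
have no_rel d : (0 < d)%N -> forall s t, irreducibles s -> irreducibles t ->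
    assoc (prods s) (prods t) -> size s <> (d + size t)%N.
  elim/ltn_ind: d => d IH d0 {}s {}t Hs Ht st sz.
  have [s' [t' [Hs' Ht' st' sz' dis]]] := cancel_common Hs Ht st.
  apply: (minimal_relation_absurd Hs' Ht' st' d0 _ dis); first by lia.
  move=> s2 t2 Hs2 Ht2 st2 lt2; rewrite leqNgt; apply/negP => lt_d.
  by apply: (IH (size s2 - size t2)%N _ _ s2 t2) => //; lia.
move=> Hs Ht st; case: (ltngtP (size s) (size t)) => // lt; exfalso.
  by apply: (no_rel (size t - size s)%N _ t s) => //; [lia|exact: assoc_sym|lia].
by apply: (no_rel (size s - size t)%N _ s t) => //; lia.
Qed.

End LengthFactorial.

Theorem theorem7 (D : idomainType) :
  factorial_domain D <-> length_factorial_domain D.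
Proof.
split=> [[atD fD]|lfD].
  split=> // n x y Hx Hy /(fD _ _ _ _ Hx Hy)[e [s Hs]].
  by exists s => i; have := Hs i; rewrite cast_ord_id.
split=> [|n m x y Hx Hy Exy]; first exact: lfD.1.
have irr k (z : 'I_k -> D) : (forall i, irreducible (z i)) ->
    irreducibles [seq z i | i <- enum 'I_k].
  by move=> Hz b /mapP[i _ ->].
(* Equality of lengths is the only gap; once [m] is replaced by [n], length-factoriality supplies
   the permutation. *)
have e : n = m.
  have := length_eq_of_assoc lfD (irr _ _ Hx) (irr _ _ Hy).
  have sz k (z : 'I_k -> D) : size [seq z i | i <- enum 'I_k] = k.
    by rewrite size_map size_enum_ord.
  have pr k (z : 'I_k -> D) : prods [seq z i | i <- enum 'I_k] = \prod_i z i.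
    by rewrite /prods big_map big_enum.
  by rewrite !sz !pr Exy; apply; apply: assoc_refl.
case: m / e y Hy Exy => y Hy Exy; exists (erefl n).
have [s Hs] := lfD.2 _ _ _ Hx Hy Exy.
by exists s => i; rewrite cast_ord_id.
Qed.
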